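(* Let $X$ be a Hadamard space and let $f: X \to \mathbb{R}$ be a continuous convex function. Then its recession function $f^{\infty}: CX^{\infty} \to \mathbb{R}\cup\{\infty\}$ is positively homogeneous and convex on the Hadamard space $(CX^{\infty}, d^{\infty})$; that is, $f^{\infty}(\alpha p) = \alpha f^{\infty}(p)$ for all $p\in CX^\infty$, $\alpha \geq 0$, and $f^{\infty}$ is convex along geodesics of $CX^\infty$.
   Context: A Hadamard space is a complete CAT(0) space; a function on it is convex if it is convex along every geodesic. A geodesic ray is a map $c:[0,\infty)\to X$ with $d(c(s),c(t))=|s-t|$; a constant-speed ray is a map $t\mapsto c(rt)$ with $c$ a geodesic ray and $r\ge 0$. Geodesic rays $c,c'$ are asymptotic if $d(c(t),c'(t))$ is bounded; $X^{\infty}$ is the set of asymptotic classes, and $c(\infty)$ denotes the class of $c$. The angle is $\angle(\xi,\xi') := \lim_{t,t'\to\infty}\overline{\angle}_x(c(t),c'(t'))\in[0,\pi]$, where $c,c'$ are the geodesic rays issuing from $x$ in the classes $\xi,\xi'$ and $\overline{\angle}_x$ is the Euclidean comparison angle (independent of $x$). The Euclidean cone $CX^{\infty}$ is $\mathbb{R}_+\times X^{\infty}$ modulo identifying all $(0,\xi)$ to a point $0$; the class of $(r,\xi)$ is written $r\xi$. It carries the metric $d^{\infty}(r\xi,r'\xi')^2 = r^2+r'^2-2rr'\cos\angle(\xi,\xi')$, with which it is a Hadamard space. For $a\ge 0$, $a(r\xi):=(ar)\xi$. A constant-speed ray $c^*(t)=c(rt)$ has $c^*(\infty):=r\,c(\infty)\in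 CX^\infty$. The recession function of $f$ is $f^{\infty}(p):=\lim_{t\to\infty} (f(c(t))-f(c(0)))/t$, where $c$ is any constant-speed ray with $c(\infty)=p$ (the value does not depend on the choice of $c$). *)

(* Defs.v *)
From HB Require Import structures.
From mathcomp Require Import all_boot all_order all_algebra generic_quotient.
From mathcomp Require Import all_classical all_reals all_analysis.

Set Implicit Arguments.
Unset Strict Implicit.
Unset Printing Implicit Defensive.

Import Order.TTheory GRing.Theory Num.Theory.
Import numFieldNormedType.Exports.

Local Open Scope classical_set_scope.
Local Open Scope ring_scope.
Local Open Scope quotient_scope.

(** Geodesics and convexity are relative to an explicit distance function, so
    that they apply both to [mdist] and to the cone metric at infinity. Paths
    and rays are total functions on [R] of which only the values on [`[0, l]],
    resp. [`[0, +oo[], matter. *)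

Section geodesics.
Context {R : realType} {T : Type}.
Implicit Types (d : T -> T -> R) (c : R -> T).

Definition is_geodesic d (l : R) c : Prop :=
  forall s t, 0 <= s <= l -> 0 <= t <= l -> d (c s) (c t) = `|s - t|.

Definition is_geodesic_ray d c : Prop :=
  forall s t, 0 <= s -> 0 <= t -> d (c s) (c t) = `|s - t|.

Definition geodesic_from_to d c (x y : T) : Prop :=
  [/\ is_geodesic d (d x y) c, c 0 = x & c (d x y) = y].

Definition geodesically_convex d (F : T -> \bar R) : Prop :=
  forall (l : R) c, 0 <= l -> is_geodesic d l c ->
  forall s t a : R, 0 <= s <= l -> 0 <= t <= l -> 0 <= a <= 1 ->
  (F (c ((1 - a) * s + a * t)%R) <=
     (1 - a)%:E * F (c s) + a%:E * F (c t))%E.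

End geodesics.

Section hadamard.
Context {R : realType}.

Definition eucl_dist (p q : R * R) : R :=
  Num.sqrt ((p.1 - q.1) ^+ 2 + (p.2 - q.2) ^+ 2).

Variable X : metricType R.
Local Notation d := (@mdist R X).

(** [p' q' r'] is a comparison triangle in the plane. The two distance
    conditions on [x'] say that it is the point of the segment [p'q']
    corresponding to [c s] (and likewise for [y']). Considering only the two
    sides issuing from [p] is no restriction: the vertices can be permuted,
    geodesics reversed, and the third side exists in a geodesic space. *)
Definition cat0 : Prop :=
  (forall x y : X, exists c, geodesic_from_to d c x y) /\
  (forall (p q r : X) (c c' : R -> X),
     geodesic_from_to d c p q -> geodesic_from_to d c' p r ->
   forall p' q' r' : R * R,
     eucl_dist p' q' = d p q -> eucl_dist p' r' = d p r ->
     eucl_dist q' r' = d q r ->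
   forall s t : R, 0 <= s <= d p q -> 0 <= t <= d p r ->
   forall x' y' : R * R,
     eucl_dist p' x' = d p (c s) -> eucl_dist x' q' = d (c s) q ->
     eucl_dist p' y' = d p (c' t) -> eucl_dist y' r' = d (c' t) r ->
   d (c s) (c' t) <= eucl_dist x' y').

Definition is_complete : Prop :=
  forall F : set_system X, ProperFilter F -> cauchy F -> exists x : X, F --> x.

Definition hadamard : Prop := is_complete /\ cat0.

(** Law of cosines; only meaningful for [y != x] and [z != x]. *)
Definition comparison_angle (x y z : X) : R :=
  acos ((d x y ^+ 2 + d x z ^+ 2 - d y z ^+ 2) / (2 * d x y * d x z)).

End hadamard.

Record ray (R : realType) (X : metricType R) := Ray {
  ray_fun :> R -> X ;
  rayP : is_geodesic_ray mdist ray_fun }.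

HB.instance Definition _ (R : realType) (X : metricType R) :=
  gen_eqMixin (ray X).
HB.instance Definition _ (R : realType) (X : metricType R) :=
  gen_choiceMixin (ray X).

Section boundary.
Context {R : realType} (X : metricType R).
Implicit Types c : ray X.

Definition asymptotic c c' : bool :=
  `[< exists B : R, forall t, 0 <= t -> mdist (c t) (c' t) <= B >].

Lemma asymptotic_refl : reflexive asymptotic.
Proof. by move=> c; apply/asboolP; exists 0 => t _; rewrite mdistxx. Qed.

Lemma asymptotic_sym : symmetric asymptotic.
Proof.
by move=> c c'; apply/asboolP/asboolP => -[B cB]; exists B => t t0;
  rewrite metric_sym cB.
Qed.

Lemma asymptotic_trans : transitive asymptotic.
Proof.
move=> c2 c1 c3 /asboolP[B cB] /asboolP[B' cB']; apply/asboolP.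
exists (B + B') => t t0.
by rewrite (le_trans (metric_triangle _ (c2 t) _))// lerD ?cB ?cB'.
Qed.

Canonical asymptotic_equiv :=
  EquivRel asymptotic asymptotic_refl asymptotic_sym asymptotic_trans.

Definition boundary := {eq_quot asymptotic}.

HB.instance Definition _ := EqQuotient.on boundary.

Definition ray_end c : boundary := \pi_boundary c.

Lemma ray_endP c c' : ray_end c = ray_end c' <-> asymptotic c c'.
Proof.
by split=> [/eqP|cc']; [rewrite eqmodE | apply/eqP; rewrite eqmodE].
Qed.

(** The angle is the unique value which is the limit for all base points [c 0]
    and all representatives; its existence for Hadamard spaces is classical. *)
Definition is_angle (xi xi' : boundary) (a : R) : Prop :=
  forall c c', ray_end c = xi -> ray_end c' = xi' -> c 0 = c' 0 ->
  comparison_angle (c 0) (c t.1) (c' t.2)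
    @[t --> filter_prod (+oo%R : set_system R) (+oo%R : set_system R)] --> a.

Definition angle (xi xi' : boundary) : R := xget 0 [set a | is_angle xi xi' a].

Definition cone_eq (u v : {nonneg R} * boundary) : bool :=
  (u.1 == v.1) && ((u.1%:num == 0) || (u.2 == v.2)).

Lemma cone_eq_refl : reflexive cone_eq.
Proof. by move=> u; rewrite /cone_eq !eqxx orbT. Qed.

Lemma cone_eq_sym : symmetric cone_eq.
Proof.
move=> u v; rewrite /cone_eq eq_sym [u.2 == _]eq_sym.
by case: eqP => //= ->.
Qed.

Lemma cone_eq_trans : transitive cone_eq.
Proof.
move=> v u w /andP[/eqP uv uv2] /andP[/eqP vw vw2].
rewrite /cone_eq uv vw eqxx /=; move: uv2 vw2; rewrite uv vw.
by case: (_ == 0) => //= /eqP -> /eqP ->.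
Qed.

Canonical cone_equiv :=
  EquivRel cone_eq cone_eq_refl cone_eq_sym cone_eq_trans.

Definition cone := {eq_quot cone_eq}.

HB.instance Definition _ := EqQuotient.on cone.

Definition cone_pt (r : {nonneg R}) (xi : boundary) : cone := \pi_cone (r, xi).

Lemma cone_ptP r xi r' xi' :
  cone_pt r xi = cone_pt r' xi' <-> r = r' /\ (r%:num = 0 \/ xi = xi').
Proof.
split=> [/eqP|[-> e]].
  by rewrite eqmodE => /andP[/eqP /= -> /orP[]/eqP]; split => //; [left|right].
by apply/eqP; rewrite eqmodE /= /cone_eq /= eqxx /=; case: e => ->;
  rewrite eqxx ?orbT.
Qed.

Definition cone_dist (p q : cone) : R :=
  let u := repr p in let v := repr q in
  Num.sqrt (u.1%:num ^+ 2 + v.1%:num ^+ 2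
            - 2 * u.1%:num * v.1%:num * cos (angle u.2 v.2)).

Lemma cone_distE r xi r' xi' :
  cone_dist (cone_pt r xi) (cone_pt r' xi') =
  Num.sqrt (r%:num ^+ 2 + r'%:num ^+ 2
            - 2 * r%:num * r'%:num * cos (angle xi xi')).
Proof.
rewrite /cone_dist.
case E: (repr (cone_pt r xi)) => [s eta].
case E': (repr (cone_pt r' xi')) => [s' eta'].
have : cone_pt s eta = cone_pt r xi by rewrite /cone_pt -E reprK.
have : cone_pt s' eta' = cone_pt r' xi' by rewrite /cone_pt -E' reprK.
move=> /cone_ptP[-> e'] /cone_ptP[-> e] /=; congr (Num.sqrt (_ - _)).
case: e => [->|->]; first by rewrite mulr0 !mul0r.
by case: e' => [->|->//]; rewrite mulr0 !mul0r.
Qed.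

Definition cone_scale (a : {nonneg R}) (p : cone) : cone :=
  cone_pt (a%:num * (repr p).1%:num)%:nng (repr p).2.

Lemma cone_scaleE a r xi :
  cone_scale a (cone_pt r xi) = cone_pt (a%:num * r%:num)%:nng xi.
Proof.
rewrite /cone_scale; case E: (repr (cone_pt r xi)) => [s eta] /=.
have : cone_pt s eta = cone_pt r xi by rewrite /cone_pt -E reprK.
move=> /cone_ptP[-> e]; apply/cone_ptP; split=> //=.
by case: e => [->|->]; [left; rewrite mulr0|right].
Qed.

(** [t |-> c (r * t)] is the constant-speed ray of speed [r] along [c]; its
    point at infinity is [cone_pt r (ray_end c)]. *)
Definition is_recession_value (f : X -> R) (p : cone) (v : \bar R) : Prop :=
  forall (c : ray X) (r : {nonneg R}), cone_pt r (ray_end c) = p ->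
  ((f (c (r%:num * t)) - f (c (r%:num * 0))) / t)%:E
    @[t --> (+oo%R : set_system R)] --> v.

(** The default [-oo] is returned when there is no common limit. Hence
    [recession f p <> -oo] entails that the limit exists for every
    constant-speed ray with [p] as point at infinity, is independent of that
    ray, and is equal to [recession f p]. *)
Definition recession (f : X -> R) (p : cone) : \bar R :=
  xget -oo%E [set v | is_recession_value f p v].

End boundary.

(* Main.v *)
Require Import Defs.
From HB Require Import structures.
From mathcomp Require Import all_boot all_order all_algebra.
From mathcomp Require Import all_classical all_reals all_analysis.
From mathcomp Require Import ring lra.
Import Order.TTheory GRing.Theory Num.Theory.
Import numFieldNormedType.Exports.
Local Open Scope classical_set_scope.
Local Open Scope ring_scope.

(** Applying the CAT(0) comparison to a hinge shows that the cosine of the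
    comparison angle along two rays with a common origin is monotone, so that
    [d (c (r t)) (c' (r' t)) / t] tends to the distance at infinity, first for
    rays with a common origin and then, since asymptotic rays stay at bounded
    distance, for arbitrary rays (that any class has a ray from any origin uses
    completeness).

    Let [p] divide a geodesic of the cone from [p1] to [p2] in the ratio
    [a : 1 - a], let [c], [c1], [c2] be constant-speed rays representing [p],
    [p1], [p2], and let [m t] divide the geodesic from [c1 t] to [c2 t] in the
    same ratio. The CN inequality gives [d (m t) (c t) = o(t)], because in the
    limit its right-hand side vanishes. Hence, for fixed [u], the point at
    fraction [u / t] of the geodesic from [c 0] to [m t] tends to [c u], and
    convexity of [f] along both geodesics bounds [f] there; continuity passes
    the bound to the limit. For [p1 = p2 = p] the same argument shows that the
    recession value does not depend on the ray. *)

(** * Comparison inequalities in CAT(0) spaces *)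

Section cat0_inequalities.
Context {R : realType} {X : metricType R}.
Local Notation d := (@mdist R X).
Implicit Types (x y z p q r : X) (c : R -> X).

Lemma geodesic_dist0 {x y c} t : geodesic_from_to d c x y ->
  0 <= t <= d x y -> d x (c t) = t.
Proof.
move=> [cg c0 _] /andP[t0 tl]; rewrite -{1}c0 cg ?sub0r ?normrN ?ger0_norm//.
  by rewrite lexx mdist_ge0.
by rewrite t0.
Qed.

Lemma geodesic_dist1 {x y c} t : geodesic_from_to d c x y ->
  0 <= t <= d x y -> d (c t) y = d x y - t.
Proof.
move=> [cg _ c1] /andP[t0 tl]; rewrite -{1}c1 cg ?t0//.
  by rewrite distrC ger0_norm// subr_ge0.
by rewrite lexx mdist_ge0.
Qed.

(** With one vertex at the origin and [q] on the first axis, the law of cosines dictates the first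
    coordinate [x] of [r]; the triangle inequalities give [|x| <= b], so a second coordinate
    exists. *)
Lemma eucl_triangle (a b e : R) : 0 <= a -> 0 <= b -> 0 <= e ->
  e <= a + b -> a <= b + e -> b <= a + e ->
  exists q r : R * R, [/\ q.1 ^+ 2 + q.2 ^+ 2 = a ^+ 2,
    r.1 ^+ 2 + r.2 ^+ 2 = b ^+ 2 &
    (q.1 - r.1) ^+ 2 + (q.2 - r.2) ^+ 2 = e ^+ 2].
Proof.
move=> a0 b0 e0 eab abe bae.
have [a_eq0|a_neq0] := eqVneq a 0.
  exists (0, 0), (b, 0) => /=.
  have -> : e = b by lra.
  by rewrite a_eq0; split; ring.
pose x := (a ^+ 2 + b ^+ 2 - e ^+ 2) / (2 * a).
have xE : 2 * a * x = a ^+ 2 + b ^+ 2 - e ^+ 2 by rewrite /x; field.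
have a_gt0 : 0 < a by rewrite lt_neqAle eq_sym a_neq0.
have xb : x <= b.
  by rewrite -(ler_pM2l (_ : 0 < 2 * a)) ?xE; [nra|lra].
have bx : - b <= x.
  by rewrite -(ler_pM2l (_ : 0 < 2 * a)) ?xE; [nra|lra].
have x2 : 0 <= b ^+ 2 - x ^+ 2 by nra.
exists (a, 0), (x, Num.sqrt (b ^+ 2 - x ^+ 2)) => /=.
rewrite sub0r sqrrN sqr_sqrtr//; split; [ring|ring|nra].
Qed.

(** The right-hand side is the squared distance of the comparison points, by
    the law of cosines; this form also covers degenerate triangles. *)
Lemma cat0_comparison p q r c c' (l m : R) : cat0 X ->
  geodesic_from_to d c p q -> geodesic_from_to d c' p r ->
  0 <= l <= 1 -> 0 <= m <= 1 ->
  d (c (l * d p q)) (c' (m * d p r)) ^+ 2 <=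
  l ^+ 2 * d p q ^+ 2 + m ^+ 2 * d p r ^+ 2
  - l * m * (d p q ^+ 2 + d p r ^+ 2 - d q r ^+ 2).
Proof.
move=> [_ cmp] cpq cpr /andP[l0 l1] /andP[m0 m1].
have [a0 b0 e0] : [/\ 0 <= d p q, 0 <= d p r & 0 <= d q r].
  by split; exact: mdist_ge0.
have := metric_triangle q p r; have := metric_triangle p r q.
have := metric_triangle p q r.
rewrite (metric_sym q p) (metric_sym r q) => t1 t2 t3.
have [[q1 q2] [[r1 r2] /= [qE rE qrE]]] :=
  eucl_triangle _ _ _ a0 b0 e0 t3 t2 t1.
have sl : 0 <= l * d p q <= d p q by rewrite mulr_ge0//= ler_piMl.
have sm : 0 <= m * d p r <= d p r by rewrite mulr_ge0//= ler_piMl.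
(* Since [p] is placed at the origin, the comparison points are multiples of the vertices; [h1] to
   [h7] verify the distances that identify them. *)
have := cmp p q r c c' cpq cpr (0, 0) (q1, q2) (r1, r2) _ _ _
  (l * d p q) (m * d p r) sl sm (l * q1, l * q2) (m * r1, m * r2).
rewrite (geodesic_dist0 _ cpq sl) (geodesic_dist0 _ cpr sm).
rewrite (geodesic_dist1 _ cpq sl) (geodesic_dist1 _ cpr sm) /eucl_dist/=.
have sqrtE u v : 0 <= u -> v = u ^+ 2 -> Num.sqrt v = u.
  by move=> u0 ->; rewrite sqrtr_sqr ger0_norm.
have l'0 : 0 <= 1 - l by rewrite subr_ge0.
have m'0 : 0 <= 1 - m by rewrite subr_ge0.
have h1 : Num.sqrt ((0 - q1) ^+ 2 + (0 - q2) ^+ 2) = d p q.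
  by apply: sqrtE => //; rewrite -qE; ring.
have h2 : Num.sqrt ((0 - r1) ^+ 2 + (0 - r2) ^+ 2) = d p r.
  by apply: sqrtE => //; rewrite -rE; ring.
have h3 : Num.sqrt ((q1 - r1) ^+ 2 + (q2 - r2) ^+ 2) = d q r by exact: sqrtE.
have h4 : Num.sqrt ((0 - l * q1) ^+ 2 + (0 - l * q2) ^+ 2) = l * d p q.
  by apply: sqrtE; [exact: mulr_ge0|rewrite exprMn -qE; ring].
have h5 : Num.sqrt ((l * q1 - q1) ^+ 2 + (l * q2 - q2) ^+ 2) =
    d p q - l * d p q.
  apply: sqrtE; first by nra.
  by rewrite -{1}(mul1r (d p q)) -mulrBl exprMn -qE; ring.
have h6 : Num.sqrt ((0 - m * r1) ^+ 2 + (0 - m * r2) ^+ 2) = m * d p r.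
  by apply: sqrtE; [exact: mulr_ge0|rewrite exprMn -rE; ring].
have h7 : Num.sqrt ((m * r1 - r1) ^+ 2 + (m * r2 - r2) ^+ 2) =
    d p r - m * d p r.
  apply: sqrtE; first by nra.
  by rewrite -{1}(mul1r (d p r)) -mulrBl exprMn -rE; ring.
move=> /(_ h1 h2 h3 h4 h5 h6 h7) dle.
rewrite (le_trans (lerXn2r 2 _ _ dle)) ?nnegrE ?mdist_ge0 ?sqrtr_ge0//.
rewrite sqr_sqrtr ?addr_ge0 ?sqr_ge0// -qE -rE -qrE le_eqVlt; apply/orP; left.
by apply/eqP; ring.
Qed.

(** At equal ratios the bound of [cat0_comparison] is the square of [l * d q r]. *)
Lemma cat0_thales p q r c c' (l : R) : cat0 X ->
  geodesic_from_to d c p q -> geodesic_from_to d c' p r -> 0 <= l <= 1 ->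
  d (c (l * d p q)) (c' (l * d p r)) <= l * d q r.
Proof.
move=> X0 cpq cpr /andP[l0 l1].
rewrite -(@ler_pXn2r _ 2%N)// ?nnegrE ?mulr_ge0 ?mdist_ge0//.
have := @cat0_comparison p q r c c' l l X0 cpq cpr.
rewrite l0 l1 => /(_ isT isT) /le_trans; apply; nra.
Qed.

Lemma geodesic_end {c x y} : geodesic_from_to d c x y -> c (1 * d x y) = y.
Proof. by rewrite mul1r => -[]. Qed.

(** The CN inequality of Bruhat and Tits, at an arbitrary ratio. *)
Lemma cat0_cn x y z c (a : R) : cat0 X -> geodesic_from_to d c x y ->
  0 <= a <= 1 ->
  d (c (a * d x y)) z ^+ 2 <=
  (1 - a) * d x z ^+ 2 + a * d y z ^+ 2 - a * (1 - a) * d x y ^+ 2.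
Proof.
move=> X0 cxy a01; have [c' cxz] := X0.1 x z.
have := @cat0_comparison x y z c c' a 1 X0 cxy cxz a01.
rewrite ler01 lexx (geodesic_end cxz) => /(_ isT)/le_trans; apply.
by rewrite le_eqVlt; apply/orP; left; apply/eqP; ring.
Qed.

End cat0_inequalities.

(** * Rays from every origin in a given asymptotic class *)

Section rays.
Context {R : realType} {X : metricType R}.
Local Notation d := (@mdist R X).
Implicit Types (x y z p q r : X) (c : ray X) (g : R -> X).

(** Two uses of [cat0_cn], for [g'] and the point [m] of [g], then for [g] and [y]; all terms but
    the square of [(1 - l) * d x y] cancel. *)
Lemma cat0_thales_end x y q g g' (l : R) : cat0 X ->
  geodesic_from_to d g x q -> geodesic_from_to d g' y q -> 0 <= l <= 1 ->
  d (g (l * d x q)) (g' (l * d y q)) <= (1 - l) * d x y.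
Proof.
move=> X0 gxq gyq /andP[l0 l1].
have l01 : 0 <= l <= 1 by rewrite l0.
have l'0 : 0 <= 1 - l by rewrite subr_ge0.
rewrite -(@ler_pXn2r _ 2%N)// ?nnegrE ?mulr_ge0 ?mdist_ge0//.
have sl : 0 <= l * d x q <= d x q.
  by rewrite mulr_ge0 ?mdist_ge0//= ler_piMl ?mdist_ge0.
set m := g (l * d x q).
have := cat0_cn _ _ m _ l X0 gyq l01; rewrite metric_sym => /le_trans; apply.
have := cat0_cn _ _ y _ l X0 gxq l01; rewrite -/m (metric_sym m).
rewrite (metric_sym q y) (metric_sym q m) (geodesic_dist1 _ gxq sl) -/m.
move=> /(ler_wpM2l l'0) h; rewrite -lerBrDr -lerBrDr; apply: (le_trans h).
by rewrite le_eqVlt; apply/orP; left; apply/eqP; ring.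
Qed.

Lemma ray_dist c (s t : R) : 0 <= s -> 0 <= t -> d (c s) (c t) = `|s - t|.
Proof. by move=> s0 t0; apply: (rayP c). Qed.

Lemma ray_dist0 c (t : R) : 0 <= t -> d (c 0) (c t) = t.
Proof. by move=> t0; rewrite ray_dist// sub0r normrN ger0_norm. Qed.

Lemma ray_geodesic c (l : R) : 0 <= l -> geodesic_from_to d c (c 0) (c l).
Proof.
move=> l0; split; rewrite ?ray_dist0// => s t /andP[s0 _] /andP[t0 _].
exact: ray_dist.
Qed.

Lemma dist_ray_bounds c x (s : R) : 0 <= s ->
  s - d x (c 0) <= d x (c s) <= s + d x (c 0).
Proof.
move=> s0; have := metric_triangle (c 0) x (c s).
have := metric_triangle x (c 0) (c s).
rewrite ray_dist0// (metric_sym (c 0) x) => h1 h2; apply/andP; split; lra.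
Qed.

(** The squared distance is at most
    [t ^+ 2 * ((s' - s) ^+ 2 - (L' - L) ^+ 2) / (L * L')] with [L = d x (c s)]
    and [L' = d x (c s')]. The numerator factors, one factor being at most
    [2 * d x (c 0)] and the other at most [2 * s'], while [L >= s / 2] and
    [L' >= s' / 2]. *)
Lemma geodesics_to_ray_close c x g g' (s s' t : R) : cat0 X ->
  geodesic_from_to d g x (c s) -> geodesic_from_to d g' x (c s') ->
  0 < s -> s <= s' -> 2 * d x (c 0) <= s -> 0 <= t -> 2 * t <= s ->
  s * d (g t) (g' t) ^+ 2 <= 16 * d x (c 0) * t ^+ 2.
Proof.
move=> X0 gx g'x s_gt0 ss' as_ t0 ts.
have s0 : 0 <= s := ltW s_gt0.
have s'0 : 0 <= s' := le_trans s0 ss'.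
have s'_gt0 : 0 < s' := lt_le_trans s_gt0 ss'.
have /andP[L1 L2] := dist_ray_bounds c x s s0.
have /andP[L'1 L'2] := dist_ray_bounds c x s' s'0.
have := metric_triangle x (c s') (c s); have := metric_triangle x (c s) (c s').
rewrite (metric_sym (c s') (c s)) ray_dist// ler0_norm ?subr_le0// opprB.
have := @cat0_comparison _ _ x (c s) (c s') g g' (t / d x (c s))
  (t / d x (c s')) X0 gx g'x.
rewrite ray_dist// ler0_norm ?subr_le0// opprB.
have a0 := mdist_ge0 x (c 0).
move: L1 L2 L'1 L'2 as_ a0.
set a := d x (c 0); set L := d x (c s); set L' := d x (c s').
move=> L1 L2 L'1 L'2 as_ a0.
have sL : s <= 2 * L by lra.
have sL' : s' <= 2 * L' by lra.
have L_gt0 : 0 < L by lra.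
have L'_gt0 : 0 < L' by lra.
rewrite !divfK ?gt_eqF// !divr_ge0 ?(ltW L_gt0) ?(ltW L'_gt0)//.
rewrite !ler_pdivrMr// !mul1r => /(_ ltac:(lra) ltac:(lra)).
set D := d (g t) (g' t) => cmp tr1 tr2.
have {}cmp : L * L' * D ^+ 2 <= t ^+ 2 * ((s' - s) ^+ 2 - (L' - L) ^+ 2).
  have LL' : 0 <= L * L' by rewrite mulr_ge0 ?ltW.
  apply: (le_trans (ler_wpM2l LL' cmp)).
  rewrite le_eqVlt; apply/orP; left; apply/eqP; field.
  by rewrite !gt_eqF.
have e1 : (s' - s) ^+ 2 - (L' - L) ^+ 2 <= 4 * a * s'.
  have -> : (s' - s) ^+ 2 - (L' - L) ^+ 2 =
    ((s' - s) - (L' - L)) * ((s' - s) + (L' - L)) by ring.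
  have -> : 4 * a * s' = (2 * a) * (2 * s') by ring.
  by apply: ler_pM; lra.
have e2 : s * s' <= 4 * (L * L').
  have -> : 4 * (L * L') = (2 * L) * (2 * L') by ring.
  exact: ler_pM.
rewrite -(ler_pM2l s'_gt0).
have e3 : s * s' * D ^+ 2 <= 4 * (L * L') * D ^+ 2.
  by rewrite ler_wpM2r ?sqr_ge0.
have e4 := ler_wpM2l (sqr_ge0 t) e1.
have -> : s' * (s * D ^+ 2) = s * s' * D ^+ 2 by ring.
apply: (le_trans e3).
have -> : s' * (16 * a * t ^+ 2) = 4 * (t ^+ 2 * (4 * a * s')) by ring.
rewrite -mulrA ler_pM2l//; exact: le_trans e4.
Qed.

(** The point [c t] is compared with the point of [g] at the same ratio [t / s], which differs from
    [g t] by [t / s] times [|s - d x (c s)|]; either error is at most [d x (c 0)]. *)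
Lemma geodesic_to_ray_near c x g (s t : R) : cat0 X ->
  geodesic_from_to d g x (c s) -> 0 < s -> 0 <= t <= s -> t <= d x (c s) ->
  d (g t) (c t) <= 2 * d x (c 0).
Proof.
move=> X0 gx s_gt0 /andP[t0 ts] tL.
have s0 := ltW s_gt0.
have /andP[L1 L2] := dist_ray_bounds c x s s0.
have a0 := mdist_ge0 x (c 0).
have L0 := mdist_ge0 x (c s).
have l0 : 0 <= t / s by rewrite divr_ge0.
have l1 : t / s <= 1 by rewrite ler_pdivrMr// mul1r.
have := cat0_thales_end x (c 0) (c s) g c (t / s) X0 gx (ray_geodesic c s s0).
rewrite l0 l1 ray_dist0// divfK ?gt_eqF// => /(_ isT) h.
have := metric_triangle (g t) (g (t / s * d x (c s))) (c t).
have [gg _ _] := gx; rewrite (gg t) ?t0//; last first.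
  by rewrite mulr_ge0//= ler_piMl.
have -> : t - t / s * d x (c s) = t / s * (s - d x (c s)).
  by field; rewrite gt_eqF.
rewrite normrM (ger0_norm l0).
have : `|s - d x (c s)| <= d x (c 0).
  by rewrite ler_distl; apply/andP; split; lra.
set N := `|_|; have N0 : 0 <= N by exact: normr_ge0.
set D := d (g t) (c t); nra.
Qed.

(** The geodesics [g n] from [x] to [c n] are pointwise Cauchy by [geodesics_to_ray_close]; their
    limit is a ray, asymptotic to [c] by [geodesic_to_ray_near]. *)
Lemma ray_from c x : hadamard X ->
  exists b : ray X, b 0 = x /\ ray_end b = ray_end c.
Proof.
move=> [Xc X0].
have [g gP] := choice (fun n : nat => X0.1 x (c n%:R)).
set a := d x (c 0); have a0 : 0 <= a by exact: mdist_ge0.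
have near_big (K : R) : \forall n \near \oo, K <= n%:R.
  exact: nbhs_infty_ger.
have lim_ex (t : R) : exists y, 0 <= t -> g n t @[n --> \oo] --> y.
  have [t0|_] := boolP (0 <= t); last by exists x.
  have [y gy] : exists y, g n t @[n --> \oo] --> y.
    apply: Xc; apply: cauchy_exP => e e0.
    (* The last term pushes the bound of [geodesics_to_ray_close] below [e ^ 2]; the others secure
       its hypotheses. *)
    pose K := 1 + 2 * a + 2 * t + 16 * a * t ^+ 2 / e ^+ 2.
    have K3 : 0 <= 16 * a * t ^+ 2 / e ^+ 2.
      by rewrite divr_ge0 ?sqr_ge0// mulr_ge0 ?sqr_ge0// mulr_ge0.
    have [N _ /(_ N (leqnn N)) NK] := near_big K.
    exists (g N t); exists N => // n /= Nn.
    rewrite ballEmdist /=.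
    have N_gt0 : 0 < N%:R :> R by rewrite /K in NK; lra.
    have := geodesics_to_ray_close c x (g N) (g n) N%:R n%:R t X0 (gP N) (gP n)
      N_gt0 _ _ t0 _.
    rewrite ler_nat => /(_ Nn ltac:(rewrite -/a /K in NK *; lra)
      ltac:(rewrite /K in NK; lra)) h.
    rewrite -(@ltr_pXn2r _ 2%N) ?nnegrE ?mdist_ge0 ?(ltW e0)//.
    rewrite -(ltr_pM2l N_gt0); apply: (le_lt_trans h).
    rewrite -ltr_pdivrMr ?exprn_gt0// -/a.
    by rewrite /K in NK; lra.
  by exists y.
have [b bP] := choice lim_ex.
(* One index good at both times, so that properties of [g n] pass to [b] with an error below [e] at
   each time. *)
have bn s t (e : R) : 0 <= s -> 0 <= t -> 0 < e -> exists n : nat,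
    [/\ d (b s) (g n s) < e, d (b t) (g n t) < e,
        0 <= s <= d x (c n%:R), 0 <= t <= d x (c n%:R) & 1 + t <= n%:R].
  move=> s0 t0 e0; rewrite s0 t0 /=; apply/(@filter_ex _ \oo).
  near=> n.
  have nK : 1 + a + s + t <= n%:R by near: n; exact: near_big.
  have /andP[L1 L2] := dist_ray_bounds c x n%:R (ler0n _ _).
  split; [| | rewrite -/a in L1; lra..].
  - near: n; have := bP s s0.
    by move/metricType_numDomainType.cvgrPdist_lt; exact.
  - near: n; have := bP t t0.
    by move/metricType_numDomainType.cvgrPdist_lt; exact.
have b_ray : is_geodesic_ray d b.
  move=> s t s0 t0; apply/eqP; rewrite -subr_eq0 -normr_le0.
  apply/ler_addgt0Pl => e e0; rewrite addr0.
  have e20 : 0 < e / 2 by rewrite divr_gt0.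
  have [n [bs bt sL tL _]] := bn s t _ s0 t0 e20.
  have [gg _ _] := gP n.
  rewrite -(gg s t sL tL) ler_norml.
  have := metric_triangle (b s) (g n s) (b t).
  have := metric_triangle (g n s) (g n t) (b t).
  have := metric_triangle (g n s) (b s) (g n t).
  have := metric_triangle (b s) (b t) (g n t).
  rewrite (metric_sym (g n t) (b t)) (metric_sym (g n s) (b s)).
  by move=> *; apply/andP; split; lra.
exists (Ray b_ray); split => /=.
  apply: mdist_positivity; apply/eqP; rewrite eq_le mdist_ge0 andbT.
  apply/ler_addgt0Pl => e e0; rewrite addr0.
  have [n [bs _ _ _ _]] := bn 0 0 e (lexx 0) (lexx 0) e0.
  by have [_ <- _] := gP n; exact: ltW.
(* Here [1] bounds the distance from [b t] to [g n t], and [2 * a] that from [g n t] to [c t]. *)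
apply/ray_endP/asboolP; exists (1 + 2 * a) => t t0 /=.
have [n [bs _ _ /andP[_ tL] tn]] := bn t t 1 t0 t0 ltr01.
have := geodesic_to_ray_near c x (g n) n%:R t X0 (gP n) ltac:(lra)
  ltac:(apply/andP; split; lra) tL.
have := metric_triangle (b t) (g n t) (c t); rewrite -/a; lra.
Unshelve. all: by end_near. Qed.

End rays.

(** * Limits of quotients [u t / t] at infinity *)

Section growth_rates.
Context {R : realType}.

Lemma cvg_cst_div_pinfty (K : R) : K / t @[t --> +oo%R] --> 0.
Proof.
apply/cvgrPdist_le => e e0; near=> t.
have t0 : 0 < t by [].
rewrite sub0r normrN normrM normfV (gtr0_norm t0) ler_pdivrMr//.
by rewrite mulrC -ler_pdivrMr.

Unshelve. all: by end_near. Qed.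

(** The arbitrary filter [F] covers limits both in [R] and in the extended reals. *)
Lemma cvg_pinfty_eq_gt {T} (f g : R -> T) (F : set_system T) (M : R) :
  (forall t, M < t -> f t = g t) ->
  f t @[t --> +oo%R] `=>` F -> g t @[t --> +oo%R] `=>` F.
Proof.
move=> fg fF; apply: cvg_trans fF; apply: near_eq_cvg.
have : \forall t \near +oo%R, M < t by apply: nbhs_pinfty_gt; rewrite num_real.
by apply: filterS => t /fg.
Qed.

(** The two quotients differ by at most [K / t]; replacing a ray by an asymptotic one is such a
    perturbation. *)
Lemma rate_bounded_perturbation (u v : R -> R) (K l : R) :
  (forall t, 0 <= t -> `|u t - v t| <= K) ->
  u t / t @[t --> +oo%R] --> l -> v t / t @[t --> +oo%R] --> l.
Proof.
move=> uvK ul.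
have uv0 : u t / t - v t / t @[t --> +oo%R] --> (0 : R).
  apply/norm_cvg0P.
  apply: (@squeeze_cvgr _ _ _ _ (cst 0) (fun t => K / t)).
  - near=> t; rewrite normr_ge0 /= -mulrBl normrM normfV.
    have t0 : 0 < t by [].
    by rewrite (gtr0_norm t0) ler_pM2r ?invr_gt0// uvK// ltW.
  - exact: cvg_cst.
  - exact: cvg_cst_div_pinfty.
have -> : (fun t => v t / t) =
    (fun t => u t / t) - (fun t => u t / t - v t / t).
  by apply/funext => t; rewrite !fctE/= subKr.
by rewrite -[l]subr0; exact: cvgB.
Unshelve. all: by end_near. Qed.

Lemma acos_le (x y : R) : -1 <= x -> x <= y -> y <= 1 -> acos y <= acos x.
Proof.
move=> x1 xy y1.
have xI : -1 <= x <= 1 by rewrite x1 (le_trans xy).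
have yI : -1 <= y <= 1 by rewrite y1 (le_trans x1).
rewrite leNgt -ltr_cos ?in_itv /= ?acos_ge0 ?acos_lepi//.
by rewrite !acosK ?in_itv//= -leNgt.
Qed.

End growth_rates.

(** * Angles at infinity and the metric of the cone *)

Section angles.
Context {R : realType} {X : metricType R}.
Local Notation d := (@mdist R X).
Implicit Types (x y z p q r : X) (c b : ray X).

(** For rays with a common origin, this is the cosine of the comparison angle there. *)
Definition chord_cos c c' (s t : R) : R :=
  (s ^+ 2 + t ^+ 2 - d (c s) (c' t) ^+ 2) / (2 * s * t).

Lemma comparison_angleE c c' s t : c 0 = c' 0 -> 0 <= s -> 0 <= t ->
  comparison_angle (c 0) (c s) (c' t) = acos (chord_cos c c' s t).
Proof.
by move=> cc' s0 t0; rewrite /comparison_angle ray_dist0// cc' ray_dist0.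
Qed.

Lemma chord_cos_itv c c' s t : c 0 = c' 0 -> 0 < s -> 0 < t ->
  -1 <= chord_cos c c' s t <= 1.
Proof.
move=> cc' s0 t0.
have st0 : 0 < 2 * s * t by rewrite !mulr_gt0.
have ds : d (c 0) (c s) = s by rewrite ray_dist0// ltW.
have dt : d (c 0) (c' t) = t by rewrite cc' ray_dist0// ltW.
have := metric_triangle (c s) (c 0) (c' t).
have := metric_triangle (c 0) (c s) (c' t).
have := metric_triangle (c 0) (c' t) (c s); have := mdist_ge0 (c s) (c' t).
rewrite (metric_sym (c s) (c 0)) (metric_sym (c' t) (c s)) ds dt.
move=> D0 h1 h2 h3.
by rewrite /chord_cos ler_pdivrMr// ler_pdivlMr//; apply/andP; split; nra.
Qed.

(** This is [cat0_comparison] at the common origin with ratios [s / s'] and [t / t'], divided by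
    [2 * s * t]. *)
Lemma chord_cos_mono c c' s t s' t' : cat0 X -> c 0 = c' 0 ->
  0 < s -> s <= s' -> 0 < t -> t <= t' ->
  chord_cos c c' s' t' <= chord_cos c c' s t.
Proof.
move=> X0 cc' s0 ss' t0 tt'.
have s'0 := lt_le_trans s0 ss'; have t'0 := lt_le_trans t0 tt'.
have := @cat0_comparison _ _ (c 0) (c s') (c' t') c c' (s / s') (t / t') X0
  (ray_geodesic c s' (ltW s'0)).
rewrite {1}cc' => /(_ (ray_geodesic c' t' (ltW t'0))).
have -> : d (c 0) (c' t') = t' by rewrite cc' ray_dist0// ltW.
rewrite ray_dist0 ?(ltW s'0)// !divfK ?gt_eqF//.
have frac_itv (u v : R) : 0 < u -> u <= v -> 0 <= u / v <= 1.
  move=> u0 uv; have v0 := lt_le_trans u0 uv.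
  by rewrite divr_ge0 ?(ltW u0) ?(ltW v0)//= ler_pdivrMr// mul1r.
rewrite !frac_itv// => /(_ isT isT) cmp.
rewrite {2}/chord_cos ler_pdivlMr ?mulr_gt0// /chord_cos.
set D := d (c s) (c' t) ^+ 2 in cmp *.
set D' := d (c s') (c' t') ^+ 2 in cmp *.
have -> : (s' ^+ 2 + t' ^+ 2 - D') / (2 * s' * t') * (2 * s * t) =
   s / s' * (t / t') * (s' ^+ 2 + t' ^+ 2 - D') by field; rewrite !gt_eqF.
have e1 : (s / s') ^+ 2 * s' ^+ 2 = s ^+ 2 by field; rewrite gt_eqF.
have e2 : (t / t') ^+ 2 * t' ^+ 2 = t ^+ 2 by field; rewrite gt_eqF.
by rewrite e1 e2 in cmp; lra.
Qed.

(** The comparison angle is nondecreasing in both parameters and at most [pi], so a single pair at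
    which it is near its supremum controls all later pairs. *)
Lemma comparison_angle_cvg c c' : cat0 X -> c 0 = c' 0 ->
  exists2 A : R, 0 <= A <= pi &
  comparison_angle (c 0) (c t.1) (c' t.2)
    @[t --> filter_prod (+oo%R : set_system R) (+oo%R : set_system R)] --> A.
Proof.
move=> X0 cc'.
pose S := [set acos (chord_cos c c' st.1 st.2) |
  st in [set st : R * R | 0 < st.1 /\ 0 < st.2]].
have Spi : ubound S pi.
  by move=> _ [[s t] [/= s0 t0] <-]; rewrite acos_lepi// chord_cos_itv.
have S1 : S (acos (chord_cos c c' 1 1)) by exists (1, 1) => //=; split.
have supS : has_sup S by split; [exists (acos (chord_cos c c' 1 1))|exists pi].
exists (sup S).
  rewrite ge_sup ?andbT//; last by case: supS.
  apply: (@le_trans _ _ (acos (chord_cos c c' 1 1))).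
    by rewrite acos_ge0// chord_cos_itv.
  by apply: ub_le_sup => //; case: supS.
apply/cvgrPdist_le => e e0.
have [_ [[s0 t0] /= [s0_gt0 t0_gt0] <-] Se] := sup_adherent e0 supS.
exists ([set s | s0 <= s], [set t | t0 <= t]) => /=.
  by split; apply: nbhs_pinfty_ge; rewrite num_real.
move=> [s t] /= [s0s t0t].
have s_gt0 := lt_le_trans s0_gt0 s0s; have t_gt0 := lt_le_trans t0_gt0 t0t.
rewrite comparison_angleE ?ltW//.
have le_sup : acos (chord_cos c c' s t) <= sup S.
  by apply: ub_le_sup; [case: supS|exists (s, t)].
rewrite ger0_norm ?subr_ge0//.
have : acos (chord_cos c c' s0 t0) <= acos (chord_cos c c' s t).
  have /andP[h1 _] := chord_cos_itv c c' s t cc' s_gt0 t_gt0.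
  have /andP[_ h2] := chord_cos_itv c c' s0 t0 cc' s0_gt0 t0_gt0.
  by apply: acos_le => //; exact: chord_cos_mono.
by move: Se; lra.
Qed.

Lemma law_of_cosines c c' s t : c 0 = c' 0 -> 0 < s -> 0 < t ->
  d (c s) (c' t) ^+ 2 =
  s ^+ 2 + t ^+ 2 - 2 * s * t * cos (comparison_angle (c 0) (c s) (c' t)).
Proof.
move=> cc' s0 t0; rewrite comparison_angleE ?ltW//.
rewrite acosK ?in_itv /= ?chord_cos_itv// /chord_cos.
by field; rewrite !gt_eqF.
Qed.

(** The law of cosines at [r * t] and [r' * t] is divided by [t ^ 2]. A zero speed is treated apart,
    since a degenerate side has no comparison angle. *)
Lemma chord_cvg_common_base c c' (A r r' : R) : c 0 = c' 0 ->
  comparison_angle (c 0) (c t.1) (c' t.2)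
    @[t --> filter_prod (+oo%R : set_system R) (+oo%R : set_system R)] --> A ->
  0 <= r -> 0 <= r' ->
  d (c (r * t)) (c' (r' * t)) / t @[t --> +oo%R] -->
    Num.sqrt (r ^+ 2 + r' ^+ 2 - 2 * r * r' * cos A).
Proof.
move=> cc' cA r0 r'0.
have [->|rN0] := eqVneq r 0.
  rewrite mulr0 !mul0r subr0 expr0n add0r sqrtr_sqr ger0_norm//.
  apply: (cvg_pinfty_eq_gt _ _ _ 0 _ (cvg_cst r')) => t t0.
  by rewrite mul0r cc' ray_dist0 ?mulr_ge0// ?ltW// mulfK ?gt_eqF.
have [->|r'N0] := eqVneq r' 0.
  rewrite mulr0 !mul0r subr0 expr0n addr0 sqrtr_sqr ger0_norm//.
  apply: (cvg_pinfty_eq_gt _ _ _ 0 _ (cvg_cst r)) => t t0.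
  rewrite mul0r -cc' metric_sym ray_dist0 ?mulr_ge0// ?ltW//.
  by rewrite mulfK ?gt_eqF.
have r_gt0 : 0 < r by rewrite lt_neqAle eq_sym rN0.
have r'_gt0 : 0 < r' by rewrite lt_neqAle eq_sym r'N0.
have cA' : comparison_angle (c 0) (c (r * t)) (c' (r' * t))
    @[t --> +oo%R] --> A.
  have scale_cvg (k : R) : 0 < k -> k * t @[t --> +oo%R] --> +oo%R.
    by move=> k0; apply: gt0_cvgMry => //; exact: cvg_id.
  exact: (cvg_comp _ _ (cvg_pair (scale_cvg r r_gt0) (scale_cvg r' r'_gt0)) cA).
pose h t := Num.sqrt (r ^+ 2 + r' ^+ 2 - 2 * r * r' *
  cos (comparison_angle (c 0) (c (r * t)) (c' (r' * t)))).
have : h t @[t --> +oo%R] -->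
    Num.sqrt (r ^+ 2 + r' ^+ 2 - 2 * r * r' * cos A).
  apply: continuous_cvg; first exact: sqrt_continuous.
  apply: cvgB; first exact: cvg_cst.
  apply: cvgM; first exact: cvg_cst.
  by apply: continuous_cvg => //; exact: continuous_cos.
apply: (cvg_pinfty_eq_gt _ _ _ 0) => t t0.
rewrite /h; set u := d _ _.
have u0 : 0 <= u / t by rewrite divr_ge0 ?mdist_ge0 ?ltW.
rewrite -[RHS](ger0_norm u0) -sqrtr_sqr; congr Num.sqrt.
rewrite expr_div_n /u law_of_cosines ?mulr_gt0//.
by field; rewrite gt_eqF.
Qed.

Lemma ray_end_bounded c b : ray_end c = ray_end b ->
  exists K, forall t, 0 <= t -> d (c t) (b t) <= K.
Proof. by move=> /ray_endP/asboolP. Qed.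

Lemma dist_diff_bound x y x' y' : `|d x y - d x' y'| <= d x x' + d y y'.
Proof.
have := metric_triangle x x' y; have := metric_triangle x' y' y.
have := metric_triangle x' x y'; have := metric_triangle x y y'.
rewrite (metric_sym x' x) (metric_sym y' y) ler_norml.
by move=> *; apply/andP; split; lra.
Qed.

(** At unit speeds both pairs of rays separate at the same rate; the rate determines the cosine of
    the angle, which is injective on [[0, pi]]. *)
Lemma angle_limit_unique c c' b b' (A B : R) :
  ray_end c = ray_end b -> ray_end c' = ray_end b' ->
  c 0 = c' 0 -> b 0 = b' 0 -> 0 <= A <= pi -> 0 <= B <= pi ->
  comparison_angle (c 0) (c t.1) (c' t.2)
    @[t --> filter_prod (+oo%R : set_system R) (+oo%R : set_system R)] --> A ->
  comparison_angle (b 0) (b t.1) (b' t.2)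
    @[t --> filter_prod (+oo%R : set_system R) (+oo%R : set_system R)] --> B ->
  A = B.
Proof.
move=> /ray_end_bounded[K cb] /ray_end_bounded[K' cb'] cc' bb' AI BI cA bB.
have l1 := chord_cvg_common_base c c' A 1 1 cc' cA ler01 ler01.
have l2 := chord_cvg_common_base b b' B 1 1 bb' bB ler01 ler01.
have l3 : d (b (1 * t)) (b' (1 * t)) / t @[t --> +oo%R] -->
    Num.sqrt (1 ^+ 2 + 1 ^+ 2 - 2 * 1 * 1 * cos A).
  apply: (rate_bounded_perturbation (fun t => d (c (1 * t)) (c' (1 * t))) _
    (K + K')) l1 => t t0; rewrite !mul1r.
  by apply: le_trans (dist_diff_bound _ _ _ _) _; rewrite lerD ?cb ?cb'.
pose L (C : R) := Num.sqrt (1 ^+ 2 + 1 ^+ 2 - 2 * 1 * 1 * cos C).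
have AB : L A = L B by exact: (cvg_unique _ l3 l2).
have := congr1 (fun u : R => u ^+ 2) AB; rewrite /L.
have cosle (u : R) : 0 <= 1 ^+ 2 + 1 ^+ 2 - 2 * 1 * 1 * cos u :> R.
  by have := cos_le1 u; lra.
rewrite !sqr_sqrtr// => h.
by apply: cos_inj; rewrite ?in_itv//; lra.
Qed.

(** The witness is the limit for one pair of rays, the second moved to the origin of the first;
    [angle_limit_unique] carries it to all other pairs. *)
Lemma angleP (xi xi' : boundary X) : hadamard X ->
  is_angle xi xi' (angle xi xi').
Proof.
move=> hX; have [Xc X0] := hX; apply: xgetPex.
have [c cxi] : exists c : ray X, ray_end c = xi.
  by exists (repr xi); rewrite /ray_end reprK.
have [c0 c0xi] : exists c : ray X, ray_end c = xi'.
  by exists (repr xi'); rewrite /ray_end reprK.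
have [c' [cc' c'xi]] := ray_from c0 (c 0) hX.
have [A AI cA] := comparison_angle_cvg c c' X0 (esym cc').
exists A => b b' bxi b'xi bb'.
have [B BI bB] := comparison_angle_cvg b b' X0 bb'.
suff -> : A = B by [].
by apply: (angle_limit_unique c c' b b') => //; congruence.
Qed.

(** Moving [c'] to the origin of [c] changes distances by a bounded amount. Through this rate the
    cone metric enters the proof of convexity. *)
Lemma chord_cvg c c' (r r' : {nonneg R}) : hadamard X ->
  d (c (r%:num * t)) (c' (r'%:num * t)) / t @[t --> +oo%R] -->
    cone_dist (cone_pt r (ray_end c)) (cone_pt r' (ray_end c')).
Proof.
move=> hX; have [b [bc' b_end]] := ray_from c' (c 0) hX.
have /ray_end_bounded[K bK] := b_end.
rewrite cone_distE -b_end.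
have := angleP (ray_end c) (ray_end b) hX c b erefl erefl (esym bc').
move=> /(chord_cvg_common_base c b _ r%:num r'%:num (esym bc')).
move=> /(_ (ge0 _) (ge0 _)); apply: (rate_bounded_perturbation _ _ K) => t t0.
apply: le_trans (dist_diff_bound _ _ _ _) _.
by rewrite mdistxx add0r bK// mulr_ge0.
Qed.

End angles.

(** * Recession functions as slopes along rays *)

Section recession_functions.
Context {R : realType} {X : metricType R}.
Local Notation d := (@mdist R X).
Context (f : X -> R)
  (fconv : geodesically_convex d (fun x => (f x)%:E)).
Implicit Types (x y : X) (c : ray X).

Lemma convex_geodesic x y g (a : R) : geodesic_from_to d g x y ->
  0 <= a <= 1 -> f (g (a * d x y)) <= (1 - a) * f x + a * f y.
Proof.
move=> [gg g0 g1] a01; have l0 := mdist_ge0 x y.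
have := fconv (d x y) g l0 gg 0 (d x y) a.
rewrite !lexx l0 => /(_ isT isT a01); rewrite mulr0 add0r g0 g1.
by rewrite -!EFinM -EFinD lee_fin.
Qed.

Definition ray_quotient c (r t : R) : R := (f (c (r * t)) - f (c (r * 0))) / t.

(** Convexity of [f] between [c 0] and [c (r * t)], at ratio [s / t]. *)
Lemma ray_quotient_mono c r s t : 0 <= r -> 0 < s -> s <= t ->
  ray_quotient c r s <= ray_quotient c r t.
Proof.
move=> r0 s0 st; have t0 := lt_le_trans s0 st.
have rt0 : 0 <= r * t := mulr_ge0 r0 (ltW t0).
have := convex_geodesic _ _ _ (s / t) (ray_geodesic c (r * t) rt0).
rewrite ray_dist0//.
have -> : s / t * (r * t) = r * s by field; rewrite gt_eqF.
have st01 : 0 <= s / t <= 1.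
  by rewrite divr_ge0 ?(ltW s0) ?(ltW t0)//= ler_pdivrMr// mul1r.
move=> /(_ st01) h; rewrite /ray_quotient mulr0 ler_pdivrMr//.
rewrite -(lerD2r (- f (c 0))) in h; apply: (le_trans h).
by rewrite le_eqVlt; apply/orP; left; apply/eqP; field; rewrite gt_eqF.
Qed.

(** The recession value as a supremum: by monotonicity it is the limit of the quotients, and it
    bounds each of them. *)
Definition ray_slope c (r : R) : \bar R :=
  ereal_sup [set (ray_quotient c r t)%:E | t in [set t : R | 0 < t]].

Lemma ray_slope_ub c r t : 0 < t ->
  ((ray_quotient c r t)%:E <= ray_slope c r)%E.
Proof. by move=> t0; apply: ereal_sup_ubound; exists t. Qed.

Lemma ray_slopeNy c r : ray_slope c r <> -oo%E.
Proof.
by move=> e; have := ray_slope_ub c r 1 ltr01; rewrite e leeNy_eq.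
Qed.

Lemma ray_slope_growth c r K t : ray_slope c r = K%:E -> 0 < t ->
  f (c (r * t)) <= f (c 0) + K * t.
Proof.
move=> cK t0; have := ray_slope_ub c r t t0.
rewrite cK lee_fin ler_pdivrMr// mulr0.
by rewrite lerBlDl.
Qed.

Lemma ray_quotient_cvg c r : 0 <= r ->
  (ray_quotient c r t)%:E @[t --> +oo%R] --> ray_slope c r.
Proof.
(* The cutoff at [1] gives a function monotone on all of [R] with the same supremum. *)
move=> r0; pose g (t : R) : \bar R := (ray_quotient c r (Num.max t 1))%:E.
have max_gt0 (t : R) : 0 < Num.max t 1 by rewrite lt_max ltr01 orbT.
have -> : ray_slope c r = ereal_sup (range g).
  apply/eqP; rewrite eq_le; apply/andP; split; apply: ge_ereal_sup.
    move=> _ [t t0 <-]; apply: (@le_trans _ _ (g t)).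
      by rewrite lee_fin ray_quotient_mono// le_max lexx.
    by apply: ereal_sup_ubound; exists t.
  by move=> _ [t _ <-]; exact: ray_slope_ub.
apply: (cvg_pinfty_eq_gt g _ _ 1).
  by move=> t t1; rewrite /g max_l// ltW.
apply: nondecreasing_cvge => s t st.
by rewrite lee_fin ray_quotient_mono// ge_max !le_max st lexx orbT.
Qed.

Context (fcont : continuous f) (X0 : cat0 X).

(** The limits say that the point at infinity of [c] lies at ratio [a] on a
    geodesic of the cone between those of [c1] and [c2]. *)
Lemma convex_ray_bound (c c1 c2 : ray X) (r r1 r2 a D K1 K2 u : R) :
  0 <= r -> 0 <= a <= 1 ->
  d (c1 (r1 * t)) (c2 (r2 * t)) / t @[t --> +oo%R] --> D ->
  d (c1 (r1 * t)) (c (r * t)) / t @[t --> +oo%R] --> a * D ->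
  d (c2 (r2 * t)) (c (r * t)) / t @[t --> +oo%R] --> (1 - a) * D ->
  (forall t, 0 < t -> f (c1 (r1 * t)) <= f (c1 0) + K1 * t) ->
  (forall t, 0 < t -> f (c2 (r2 * t)) <= f (c2 0) + K2 * t) ->
  0 < u -> f (c (r * u)) <= f (c 0) + ((1 - a) * K1 + a * K2) * u.
Proof.
move=> r0 a01 lim12 lim1 lim2 growth1 growth2 u0.
have /andP[a0 a1] := a01.
have a'0 : 0 <= 1 - a by rewrite subr_ge0.
apply/ler_addgt0Pl => e e0; have e20 : 0 < e / 2 by rewrite divr_gt0.
have [eta eta0 feta] : exists2 eta, 0 < eta &
    forall z, d (c (r * u)) z < eta -> `|f (c (r * u)) - f z| < e / 2.
  have /cvgrPdist_lt/(_ _ e20) := fcont (c (r * u)).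
  by move=> /metricType_numDomainType.nbhs_mdistP[eta /= eta0 h]; exists eta.
(* The bound of [cat0_cn] on the squared distance from [m] to [c (r * t)], divided by [t ^ 2]. *)
pose G t := (1 - a) * (d (c1 (r1 * t)) (c (r * t)) / t) ^+ 2
  + a * (d (c2 (r2 * t)) (c (r * t)) / t) ^+ 2
  - a * (1 - a) * (d (c1 (r1 * t)) (c2 (r2 * t)) / t) ^+ 2.
have sqr_cvg (h : R -> R) (l : R) : h t @[t --> +oo%R] --> l ->
    h t ^+ 2 @[t --> +oo%R] --> l ^+ 2.
  by move=> hl; rewrite expr2; exact: cvgM.
have G0 : G t @[t --> +oo%R] --> (0 : R).
  have -> : 0 = (1 - a) * (a * D) ^+ 2 + a * ((1 - a) * D) ^+ 2
    - a * (1 - a) * D ^+ 2 by ring.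
  by apply: cvgB; [apply: cvgD|]; apply: cvgMr; exact: sqr_cvg.
pose B := (1 - a) * f (c1 0) + a * f (c2 0).
(* This yields [d m (c (r * t)) < eta / u * t], which contraction by [u / t] towards [c 0] turns
   into [eta]. *)
have G_lt : \forall t \near +oo%R, G t < (eta / u) ^+ 2.
  by apply: (cvgr_lt _ G0); rewrite exprn_gt0// divr_gt0.
have B_lt : \forall t \near +oo%R, u * (B - f (c 0)) / t < e / 2.
  exact: (cvgr_lt _ (cvg_cst_div_pinfty _)).
have [t [[ut Gt] Bt]] :=
  filter_ex (filterI (filterI (nbhs_pinfty_gt (num_real u)) G_lt) B_lt).
have t0 : 0 < t := lt_trans u0 ut.
have [g gP] := X0.1 (c1 (r1 * t)) (c2 (r2 * t)).
pose m := g (a * d (c1 (r1 * t)) (c2 (r2 * t))).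
have fm : f m <= B + ((1 - a) * K1 + a * K2) * t.
  apply: le_trans (convex_geodesic _ _ _ _ gP a01) _.
  have := ler_wpM2l a'0 (growth1 t t0); have := ler_wpM2l a0 (growth2 t t0).
  by rewrite /B => h1 h2; lra.
have dm : d m (c (r * t)) < eta / u * t.
  rewrite -(@ltr_pXn2r _ 2%N) ?nnegrE ?mdist_ge0//; last first.
    by rewrite mulr_ge0 ?divr_ge0 ?ltW.
  apply: le_lt_trans (cat0_cn _ _ _ _ _ X0 gP a01) _.
  rewrite exprMn -ltr_pdivrMr ?exprn_gt0//; apply: le_lt_trans Gt.
  rewrite le_eqVlt; apply/orP; left; apply/eqP; rewrite /G; field.
  by rewrite gt_eqF.
have [h hP] := X0.1 (c 0) m.
have ut01 : 0 <= u / t <= 1.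
  by rewrite divr_ge0 ?(ltW u0) ?(ltW t0)//= ler_pdivrMr// mul1r ltW.
pose w := h (u / t * d (c 0) m).
have fw : f w <= (1 - u / t) * f (c 0) + u / t * f m.
  exact: convex_geodesic hP ut01.
have dw : d (c (r * u)) w < eta.
  have rt0 : 0 <= r * t by rewrite mulr_ge0// ltW.
  have := cat0_thales _ _ _ _ _ _ X0 hP (ray_geodesic c (r * t) rt0) ut01.
  rewrite ray_dist0//.
  have -> : u / t * (r * t) = r * u by field; rewrite gt_eqF.
  rewrite metric_sym => /le_lt_trans; apply.
  have -> : eta = u / t * (eta / u * t) by field; rewrite !gt_eqF.
  by rewrite ltr_pM2l// divr_gt0.
have := feta w dw; rewrite ltr_norml => /andP[_ fcw].
have utfm : u / t * f m <= u / t * (B + ((1 - a) * K1 + a * K2) * t).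
  by rewrite ler_wpM2l//; case/andP: ut01.
(* The middle term is below [e / 2] by [B_lt]; continuity of [f] accounts for the other half. *)
have E : (1 - u / t) * f (c 0) + u / t * (B + ((1 - a) * K1 + a * K2) * t) =
   f (c 0) + u * (B - f (c 0)) / t + ((1 - a) * K1 + a * K2) * u.
  by field; rewrite gt_eqF.
lra.
Qed.

Lemma cone_pt_bounded c c' (r r' : {nonneg R}) :
  cone_pt r (ray_end c) = cone_pt r' (ray_end c') ->
  exists K, forall t, 0 <= t -> d (c (r%:num * t)) (c' (r'%:num * t)) <= K.
Proof.
move=> /cone_ptP[<- [->|/ray_end_bounded[K cK]]].
  by exists (d (c 0) (c' 0)) => t _; rewrite mul0r.
by exists K => t t0; apply: cK; rewrite mulr_ge0.
Qed.

(** A degenerate case of [convex_ray_bound], with [c1 = c2 = c'] and [D = 0]; by symmetry the slopes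
    are equal. *)
Lemma ray_slope_le c c' (r r' : {nonneg R}) :
  cone_pt r (ray_end c) = cone_pt r' (ray_end c') ->
  (ray_slope c r%:num <= ray_slope c' r'%:num)%E.
Proof.
move=> /cone_pt_bounded[K cK].
case E : (ray_slope c' r'%:num) => [k||]; last first.
- by have := ray_slopeNy c' r'%:num.
- by rewrite leey.
have lim0 : d (c' (r'%:num * t)) (c (r%:num * t)) / t @[t --> +oo%R]
    --> (0 : R).
  apply: (rate_bounded_perturbation (fun=> 0) _ K).
    by move=> t t0; rewrite sub0r normrN ger0_norm ?mdist_ge0// metric_sym cK.
  by under eq_fun do rewrite mul0r; exact: cvg_cst.
have growth := fun t => ray_slope_growth c' r'%:num k t E.
have c'c'0 : d (c' (r'%:num * t)) (c' (r'%:num * t)) / t @[t --> +oo%R]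
    --> (0 : R).
  by under eq_fun do rewrite mdistxx mul0r; exact: cvg_cst.
apply: ge_ereal_sup => _ [t t0 <-].
have := convex_ray_bound c c' c' r%:num r'%:num r'%:num 0 0 k k t.
rewrite !mulr0 subr0 mul1r mul0r addr0 lexx ler01.
move=> /(_ (ge0 _) isT c'c'0 lim0 lim0 growth growth t0) h.
by rewrite lee_fin ler_pdivrMr// mulr0 lerBlDl.
Qed.

(** By [ray_slope_le] the slope is the limit along every ray with this end, so [xget] finds a value,
    and limits are unique. *)
Lemma recession_ray c (r : {nonneg R}) :
  recession f (cone_pt r (ray_end c)) = ray_slope c r%:num.
Proof.
have rec : is_recession_value f (cone_pt r (ray_end c)) (ray_slope c r%:num).
  move=> c' r' e.
  have -> : ray_slope c r%:num = ray_slope c' r'%:num.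
    by apply/eqP; rewrite eq_le !ray_slope_le.
  exact: ray_quotient_cvg.
have := xgetPex -oo%E (ex_intro _ _ rec) c r erefl.
move=> h; exact: (cvg_unique _ h (ray_quotient_cvg c r%:num (ge0 _))).
Qed.

Lemma ray_slope_scale_le c (k r : R) : 0 < k ->
  (ray_slope c (k * r) <= k%:E * ray_slope c r)%E.
Proof.
move=> k0; apply: ge_ereal_sup => _ [t t0 <-].
have -> : ray_quotient c (k * r) t = k * ray_quotient c r (k * t).
  rewrite /ray_quotient !mulr0; have -> : r * (k * t) = k * r * t by ring.
  field.
  by rewrite !gt_eqF.
by rewrite EFinM lee_wpmul2l ?lee_fin ?(ltW k0)// ray_slope_ub// mulr_gt0.
Qed.

(** For [k > 0] the converse of [ray_slope_scale_le] is its instance at [k^-1]; for [k = 0] all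
    quotients vanish, in accordance with [0 * +oo = 0]. *)
Lemma ray_slope_scale c (k r : R) : 0 <= k ->
  ray_slope c (k * r) = (k%:E * ray_slope c r)%E.
Proof.
rewrite le_eqVlt => /predU1P[<-|k0].
  have q0 t : ray_quotient c (0 * r) t = 0.
    by rewrite /ray_quotient !mul0r subrr mul0r.
  rewrite mul0e; apply/eqP; rewrite eq_le; apply/andP; split.
    by apply: ge_ereal_sup => _ [t _ <-]; rewrite q0.
  by have := ray_slope_ub c (0 * r) 1 ltr01; rewrite q0.
apply/eqP; rewrite eq_le ray_slope_scale_le//=.
have := ray_slope_scale_le c k^-1 (k * r).
rewrite invr_gt0 mulrA mulVf ?gt_eqF// mul1r => /(_ k0) h.
have k0' : (0 <= k%:E)%E by rewrite lee_fin ltW.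
apply: (le_trans (lee_wpmul2l k0' h)).
by rewrite muleA -EFinM mulfV ?gt_eqF// mul1e.
Qed.

Lemma cone_ray (p : cone X) : exists (c : ray X) (r : {nonneg R}),
  p = cone_pt r (ray_end c).
Proof.
exists (repr (repr p).2), (repr p).1.
by rewrite /ray_end reprK /cone_pt -surjective_pairing reprK.
Qed.

End recession_functions.

Theorem theorem2p11 (R : realType) (X : metricType R) (hX : hadamard X)
    (f : X -> R) (fcont : continuous f)
    (fconv : geodesically_convex (@mdist R X) (fun x => (f x)%:E)) :
  [/\ forall p : cone X, recession f p <> -oo%E,
      forall (a : {nonneg R}) (p : cone X),
        recession f (cone_scale a p) = (a%:num%:E * recession f p)%E
    & geodesically_convex (@cone_dist R X) (recession f)].
Proof.
have X0 : cat0 X := hX.2.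
have recE := recession_ray f fconv fcont X0.
split.
- by move=> p; have [c [r ->]] := cone_ray p; rewrite recE; exact: ray_slopeNy.
- move=> a p; have [c [r ->]] := cone_ray p.
  by rewrite cone_scaleE !recE ray_slope_scale.
move=> l g l0 gg s t a sl tl a01.
(* For [0 < a < 1] an infinite slope at either end makes the right-hand side [+oo]; the extreme
   ratios are trivial as [0 * +oo = 0]. *)
have [->|aN0] := eqVneq a 0.
  by rewrite subr0 mul1r mul0r addr0 mul1e mul0e adde0.
have [->|aN1] := eqVneq a 1.
  by rewrite subrr mul1r mul0r add0r mul1e mul0e add0e.
have /andP[a0 a1] := a01.
have a_gt0 : 0 < a by rewrite lt_neqAle eq_sym aN0.
have a'_gt0 : 0 < 1 - a by rewrite subr_gt0 lt_neqAle aN1.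
set u := (1 - a) * s + a * t.
have ul : 0 <= u <= l.
  by move: sl tl => /andP[? ?] /andP[? ?]; apply/andP; split; rewrite /u; nra.
have dst := gg s t sl tl.
(* These distances are the limits required by [convex_ray_bound], with [D] equal to [|s - t|]. *)
have dsu : cone_dist (g s) (g u) = a * `|s - t|.
  have -> : a * `|s - t| = `|a * (s - t)| by rewrite normrM ger0_norm.
  by rewrite gg//; congr `|_|; rewrite /u; ring.
have dtu : cone_dist (g t) (g u) = (1 - a) * `|s - t|.
  have -> : (1 - a) * `|s - t| = `|(1 - a) * (t - s)|.
    by rewrite normrM distrC ger0_norm// ltW.
  by rewrite gg//; congr `|_|; rewrite /u; ring.
have [c1 [r1 e1]] := cone_ray (g s); have [c2 [r2 e2]] := cone_ray (g t).
have [c [r e]] := cone_ray (g u).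
rewrite e1 e2 e in dst dsu dtu *; rewrite !recE.
case E1 : (ray_slope f c1 r1%:num) => [K1||]; last first.
- by have := ray_slopeNy f c1 r1%:num.
- rewrite gt0_muley ?lte_fin//.
  case E2 : (ray_slope f c2 r2%:num) => [K2||]; last first.
  + by have := ray_slopeNy f c2 r2%:num.
  + by rewrite gt0_muley ?lte_fin// leey.
  + by rewrite leey.
case E2 : (ray_slope f c2 r2%:num) => [K2||]; last first.
- by have := ray_slopeNy f c2 r2%:num.
- by rewrite gt0_muley ?lte_fin// leey.
(* Both slopes are now finite, and the slope at [g u] is a supremum, so each quotient is bounded
   separately. *)
apply: ge_ereal_sup => _ [v v0 <-].
rewrite -!EFinM -EFinD lee_fin ler_pdivrMr// mulr0 lerBlDl.
have lim12 := chord_cvg c1 c2 r1 r2 hX; rewrite dst in lim12.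
have lim1 := chord_cvg c1 c r1 r hX; rewrite dsu in lim1.
have lim2 := chord_cvg c2 c r2 r hX; rewrite dtu in lim2.
apply: (convex_ray_bound f fconv fcont X0 c c1 c2 _ _ _ _ _ _ _ _ (ge0 _) a01
  lim12 lim1 lim2) => // x x0; exact: ray_slope_growth.
Qed.
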